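(* Let $\Phi:\mathbb{R}_{+}\rightarrow\mathbb{R}$ be a continuous function. Then $\Phi$ is strongly subadditive if and only if $\Phi$ is concave and $\Phi(0)\geq 0$. Respectively, $\Phi$ is strongly superadditive if and only if $\Phi$ is convex and $\Phi(0)\leq 0$.
   Context: $\mathbb{R}_{+}=[0,\infty)$. Let $\mathcal{C}$ be a convex cone in a real linear space, i.e. $a\mathbf{x}+b\mathbf{y}\in\mathcal{C}$ whenever $a,b>0$ and $\mathbf{x},\mathbf{y}\in\mathcal{C}$ (here $\mathcal{C}=\mathbb{R}_{+}$). A function $\Phi:\mathcal{C}\to\mathbb{R}$ is subadditive if $\Phi(\mathbf{x}+\mathbf{y})\leq\Phi(\mathbf{x})+\Phi(\mathbf{y})$ for all $\mathbf{x},\mathbf{y}\in\mathcal{C}$. It is strongly subadditive if it is subadditive and in addition $\Phi(\mathbf{x}+\mathbf{y}+\mathbf{z})+\Phi(\mathbf{z})\leq\Phi(\mathbf{x}+\mathbf{z})+\Phi(\mathbf{y}+\mathbf{z})$ for all $\mathbf{x},\mathbf{y},\mathbf{z}\in\mathcal{C}$. It is superadditive (respectively strongly superadditive) if $-\Phi$ is subadditive (respectively strongly subadditive). *)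

(* Defs.v *)
From HB Require Import structures.
From mathcomp Require Import all_boot all_order all_algebra.
From mathcomp Require Import all_classical all_reals all_analysis.

Set Implicit Arguments.
Unset Strict Implicit.
Unset Printing Implicit Defensive.

Import Order.TTheory GRing.Theory Num.Theory.
Import numFieldNormedType.Exports.

Local Open Scope classical_set_scope.
Local Open Scope ring_scope.
Local Open Scope convex_scope.

Definition convex_cone (R : realType) (V : lmodType R) (C : set V) : Prop :=
  forall (a b : R) (x y : V), 0 < a -> 0 < b -> C x -> C y ->
    C (a *: x + b *: y).

(* A function C -> R is represented by a function on the whole space V. When C
   is a convex cone, the predicates below only depend on its values on C. *)

Definition subadditive_on (R : realType) (V : lmodType R) (C : set V)
    (f : V -> R) : Prop :=
  forall x y : V, C x -> C y -> f (x + y) <= f x + f y.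

Definition strongly_subadditive_on (R : realType) (V : lmodType R) (C : set V)
    (f : V -> R) : Prop :=
  subadditive_on C f /\
  forall x y z : V, C x -> C y -> C z ->
    f (x + y + z) + f z <= f (x + z) + f (y + z).

Definition strongly_superadditive_on (R : realType) (V : lmodType R)
    (C : set V) (f : V -> R) : Prop :=
  strongly_subadditive_on C (fun x => - f x).

(* Mirrors [convex_function], with the inequality reversed. *)
Definition concave_function (R : numFieldType) (E : lmodType R)
    (E' := convex_lmodType E) (D : set E') (f : E' -> R^o) : Prop :=
  forall t : {i01 R},
    {in D &, forall x y : E', f x <| t |> f y <= f (x <| t |> y)}.

Lemma convex_cone_nonneg (R : realType) :
  convex_cone (`[0, +oo[%classic : set R^o).
Proof.
move=> a b x y a0 b0; rewrite /= !in_itv /= !andbT => x0 y0.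
by apply: addr_ge0; apply: mulr_ge0 => //; exact: ltW.
Qed.

(* Main.v *)
Require Import Defs.
From HB Require Import structures.
From mathcomp Require Import all_boot all_order all_algebra.
From mathcomp Require Import all_classical all_reals all_analysis.
From mathcomp Require Import ring lra.

Set Implicit Arguments.
Unset Strict Implicit.
Unset Printing Implicit Defensive.

Import Order.TTheory GRing.Theory Num.Theory.
Import numFieldNormedType.Exports.

Local Open Scope classical_set_scope.
Local Open Scope ring_scope.

(** Strong subadditivity says that the increments of [Phi] over steps of a fixed
    length decrease, which concavity gives by writing [z + x] and [z + y] as
    complementary convex combinations of [z] and [z + x + y]. Conversely, if
    [Phi] is continuous and midpoint concave, then [Phi] minus a chord over
    [a, b] attains its minimum on [a, b] at some [c]. Centering at [c] the
    largest symmetric interval contained in [a, b], midpoint concavity shows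
    that the minimum is also attained at an endpoint, where the difference is
    zero. *)

Lemma midpoint_concave_ge0 (R : realType) (g : R -> R) (a b : R) :
  {within `[a, b], continuous g} ->
  (forall u h, 0 <= h -> a <= u - h -> u + h <= b ->
     g (u - h) + g (u + h) <= g u + g u) ->
  0 <= g a -> 0 <= g b ->
  forall x, a <= x <= b -> 0 <= g x.
Proof.
move=> cg mg ga gb x /andP[ax xb].
have [c + minc] := EVT_min (le_trans ax xb) cg.
rewrite in_itv/= => /andP[ac cb].
have gcx : g c <= g x by apply: minc; rewrite in_itv/= ax.
apply: le_trans gcx.
(* If [a] is the nearer endpoint, the midpoint inequality bounds [g a + g (c + (c - a))] by
   [g c + g c]; minimality at [c] bounds the second term below by [g c], leaving
   [0 <= g a <= g c]. *)
have [cab|cab] := leP (c - a) (b - c).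
  have h0 : 0 <= c - a by rewrite subr_ge0.
  have := mg c (c - a) h0; rewrite subKr => /(_ (lexx a)).
  have cb' : c + (c - a) <= b by lra.
  move=> /(_ cb').
  have : g c <= g (c + (c - a)) by apply: minc; rewrite in_itv/=; lra.
  lra.
have h0 : 0 <= b - c by rewrite subr_ge0.
have ac' : a <= c - (b - c) by lra.
have := mg c (b - c) h0 ac'; rewrite subrKC => /(_ (lexx b)).
have : g c <= g (c - (b - c)) by apply: minc; rewrite in_itv/=; lra.
lra.
Qed.

Lemma midpoint_concave_chord (R : realType) (f : R -> R) (a b t : R) :
  {within `[a, b], continuous f} ->
  (forall u h, 0 <= h -> a <= u - h -> u + h <= b ->
     f (u - h) + f (u + h) <= f u + f u) ->
  a < b -> 0 <= t <= 1 ->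
  t * f a + (1 - t) * f b <= f (t * a + (1 - t) * b).
Proof.
move=> cf mf ab /andP[t0 t1].
have ba0 : b - a != 0 by rewrite subr_eq0 gt_eqF.
pose k := (f b - f a) / (b - a).
have kE : k * (b - a) = f b - f a by rewrite /k divfK.
pose l x : R := f a + k * (x - a).
have cl : continuous l.
  move=> x; apply: cvgD; first exact: cvg_cst.
  by apply: cvgMr; apply: cvgB; [exact: cvg_id|exact: cvg_cst].
have cg : {within `[a, b], continuous (f - l)}.
  by apply: within_continuousB => //; exact: continuous_subspaceT.
have gE x : (f - l) x = f x - (f a + k * (x - a)) by [].
have := midpoint_concave_ge0 cg.
(* The chord [l] is affine, so it satisfies the midpoint inequality with equality and can be
   subtracted. *)
have mg u h : 0 <= h -> a <= u - h -> u + h <= b ->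
    (f - l) (u - h) + (f - l) (u + h) <= (f - l) u + (f - l) u.
  by move=> h0 au ub; rewrite !gE; have := mf u h h0 au ub; lra.
have ga : (f - l) a = 0 by rewrite gE; ring.
have gb : (f - l) b = 0 by rewrite gE kE; ring.
move=> /(_ mg); rewrite ga gb lexx => /(_ isT isT (t * a + (1 - t) * b)).
have xab : a <= t * a + (1 - t) * b <= b by apply/andP; split; nra.
move=> /(_ xab); rewrite gE.
have -> : k * (t * a + (1 - t) * b - a) = (1 - t) * (k * (b - a)) by ring.
rewrite kE; lra.
Qed.

Lemma concave_functionE (R : realType) (D : set R^o) (f : R -> R) :
  concave_function D f <->
  forall t x y, 0 <= t <= 1 -> D x -> D y ->
    t * f x + (1 - t) * f y <= f (t * x + (1 - t) * y).
Proof.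
split => [cf t x y /andP[t0 t1] Dx Dy|cf t x y].
  (* On [R^o] the abstract convex combination is convertible to [t * x + (1 - t) * y]. *)
  by have := cf (Itv01 t0 t1) x y (mem_set Dx) (mem_set Dy).
move=> /set_mem Dx /set_mem Dy.
by apply: (cf t%:num x y) => //; rewrite ge0 le1.
Qed.

Lemma convex_function_concaveN (R : realType) (D : set R^o) (f : R -> R) :
  convex_function D f <-> concave_function D (fun x => - f x).
Proof.
split=> cf t x y Dx Dy.
  by rewrite -convN lerN2; exact: cf.
by rewrite -lerN2 convN; exact: cf.
Qed.

Lemma strongly_subadditive_concave (R : realType) (f : R -> R) :
  {within `[0, +oo[, continuous f} ->
  strongly_subadditive_on (`[0, +oo[%classic : set R^o) f ->
  concave_function (`[0, +oo[%classic : set R^o) f.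
Proof.
move=> cf [_ sf]; apply/concave_functionE.
have chord a b t : 0 <= a -> a < b -> 0 <= t <= 1 ->
    t * f a + (1 - t) * f b <= f (t * a + (1 - t) * b).
  move=> a0 ab t01; apply: midpoint_concave_chord => //.
    apply: continuous_subspaceW cf => z /=; rewrite !in_itv/= andbT.
    by move=> /andP[az _]; exact: le_trans az.
  (* Two equal steps [h] starting from [u - h] turn strong subadditivity into midpoint concavity at
     [u]. *)
  move=> u h h0 au _; have := sf h h (u - h).
  rewrite /= !in_itv/= !andbT => /(_ h0 h0 (le_trans a0 au)).
  by rewrite -addrA [h + (u - h)]addrC subrK [h + u]addrC [leLHS]addrC.
move=> t x y t01; rewrite /= !in_itv/= !andbT => x0 y0.
have [xy|yx|->] := ltgtP x y; first exact: chord.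
  have t01' : 0 <= 1 - t <= 1 by lra.
  have := chord y x (1 - t) y0 yx t01'; rewrite subKr.
  by rewrite [leLHS]addrC [_ * y + _]addrC.
by rewrite -!mulrDl subrKC !mul1r.
Qed.

Lemma concave_strongly_subadditive (R : realType) (f : R -> R) :
  concave_function (`[0, +oo[%classic : set R^o) f -> 0 <= f 0 ->
  strongly_subadditive_on (`[0, +oo[%classic : set R^o) f.
Proof.
move=> /concave_functionE cf f0.
have sf (x y z : R) : 0 <= x -> 0 <= y -> 0 <= z ->
    f (x + y + z) + f z <= f (x + z) + f (y + z).
  move=> x0 y0 z0.
  have [xy0|xy0] := eqVneq (x + y) 0.
    have [-> ->] : x = 0 /\ y = 0 by split; lra.
    by rewrite !add0r.
  have xy_gt0 : 0 < x + y by rewrite lt_neqAle eq_sym xy0 addr_ge0.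
  (* With this weight, [x + z] is [t * (x + y + z) + (1 - t) * z], and [y + z] is the same with [t]
     and [1 - t] exchanged. Adding the two concavity inequalities makes the weights sum to one. *)
  pose t := x / (x + y).
  have tE : t * (x + y) = x by rewrite /t divfK.
  have t01 : 0 <= t <= 1.
    by rewrite /t divr_ge0 ?(ltW xy_gt0)//= ler_pdivrMr// mul1r lerDl.
  have t01' : 0 <= 1 - t <= 1 by lra.
  have pz : `[0, +oo[%classic z by rewrite /= in_itv/= z0.
  have ps : `[0, +oo[%classic (x + y + z) by rewrite /= in_itv/= !addr_ge0.
  have := cf _ _ _ t01 ps pz; have := cf _ _ _ t01' ps pz.
  have -> : t * (x + y + z) + (1 - t) * z = t * (x + y) + z by ring.
  have -> : (1 - t) * (x + y + z) + (1 - (1 - t)) * z =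
            x + y - t * (x + y) + z by ring.
  rewrite tE [x + y - x]addrAC subrr add0r; lra.
split=> [x y|x y z]; rewrite /= !in_itv/= !andbT => x0 y0; last exact: sf.
(* At [z = 0] the inequality has the extra term [f 0] on the left, which is dropped since
   [0 <= f 0]. *)
by have := sf x y 0 x0 y0 (lexx 0); rewrite !addr0; apply: le_trans; rewrite lerDl.
Qed.

Lemma strongly_subadditiveE (R : realType) (f : R -> R) :
  {within `[0, +oo[, continuous f} ->
  strongly_subadditive_on (`[0, +oo[%classic : set R^o) f <->
    concave_function (`[0, +oo[%classic : set R^o) f /\ 0 <= f 0.
Proof.
move=> cf; split=> [sf|[]]; last exact: concave_strongly_subadditive.
split; first exact: strongly_subadditive_concave.
(* Subadditivity at the origin reads [f 0 <= f 0 + f 0]. *)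
have [+ _] := sf => /(_ 0 0); rewrite /= in_itv/= lexx addr0 lerDl.
exact.
Qed.

Theorem theorem1 (R : realType) (Phi : R -> R)
    (Phi_cont : {within (`[0, +oo[%classic : set R), continuous Phi}) :
  (strongly_subadditive_on (`[0, +oo[%classic : set R^o) Phi <->
     concave_function (`[0, +oo[%classic : set R^o) Phi /\ 0 <= Phi 0) /\
  (strongly_superadditive_on (`[0, +oo[%classic : set R^o) Phi <->
     convex_function (`[0, +oo[%classic : set R^o) Phi /\ Phi 0 <= 0).
Proof.
split; first exact: strongly_subadditiveE.
have cN : {within `[0, +oo[, continuous (fun x => - Phi x)}.
  by move=> x; apply: cvgN; exact: Phi_cont.
(* The superadditive half is the subadditive one for [- Phi]. *)
by rewrite convex_function_concaveN -oppr_ge0; exact: strongly_subadditiveE.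
Qed.
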